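(* Define the integer sequence $v(n)$ by $v(n)=0$ for $n<0$ and, for all integers $n\geq 0$, \[ v(n) + \sum_{j\geq 1} (-1)^j\Big( v(n-j^2) + v(n-2j^2)\Big) = \begin{cases} 1 & \text{if } n=0,\\ 0 & \text{otherwise,}\end{cases} \] i.e. $v(n) - v(n-1) - v(n-2) + v(n-4) + v(n-8) - v(n-9) - v(n-18) + v(n-16) + \cdots$ equals $1$ if $n=0$ and $0$ otherwise. Then for every even $n\geq 0$, $v(n) = \overline{p}(n/2)$, and for every odd $n\geq 1$, $v(n) = \overline{p}_r((n-1)/2)$.
   Context: An overpartition of $m$ is a partition of $m$ in which the first occurrence of each part size may optionally be overlined (equivalently, a two-color partition where parts of the second, ''overlined'', color are distinct); $\overline{p}(m)$ denotes the number of overpartitions of $m$, with generating function $\sum_{m\geq0}\overline{p}(m)x^m=\prod_{k\geq1}\frac{1+x^k}{1-x^k}$. $\overline{p}_r(m)$ denotes the number of overpartitions of $m$ in which the overlined parts are either even (appearing in one color) or congruent to $1$ or $7$ modulo $8$ (each such size may appear overlined in two colors, each at most once); equivalently $\sum_{m\geq 0}\overline{p}_r(m)x^m = \prod_{k\geq1}\frac{(1+x^{2k})(1+x^{8k-1})^2(1+x^{8k-7})^2}{1-x^k}$. *)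

(* Defs.v *)
From mathcomp Require Import all_boot all_order all_algebra.
Set Implicit Arguments. Unset Strict Implicit. Unset Printing Implicit Defensive.
Import GRing.Theory Num.Theory.

(* An overpartition of m, in the two-colour encoding: for each part size
   k = i+1 (i : 'I_m) a pair (a, b) where a = number of non-overlined copies
   of k and b = whether an overlined copy of k is present.  All part sizes
   are <= m and multiplicities are <= m, so this finite type covers all of them. *)
Definition opart_weight m (f : {ffun 'I_m -> 'I_m.+1 * bool}) : nat :=
  \sum_(i < m) (i.+1 * ((f i).1 + (f i).2)).

Definition pbar (m : nat) : nat :=
  #|[set f : {ffun 'I_m -> 'I_m.+1 * bool} | opart_weight f == m]|.

(* Restricted overpartitions: for each part size k = i+1 a triple (a, b, c)
   with a = number of non-overlined copies, b = overlined copy in colour 1,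
   c = overlined copy in colour 2.  Allowed: overlined parts even (one colour
   only, so c = false), or congruent to 1 or 7 mod 8 (both colours allowed);
   other odd sizes may not be overlined. *)
Definition ropart_ok m (f : {ffun 'I_m -> 'I_m.+1 * bool * bool}) : bool :=
  [forall i : 'I_m,
     let k := i.+1 in
     if ~~ odd k then ~~ (f i).2
     else if (k %% 8 == 1) || (k %% 8 == 7) then true
     else ~~ (f i).1.2 && ~~ (f i).2].

Definition ropart_weight m (f : {ffun 'I_m -> 'I_m.+1 * bool * bool}) : nat :=
  \sum_(i < m) (i.+1 * ((f i).1.1 + (f i).1.2 + (f i).2)).

Definition pbar_r (m : nat) : nat :=
  #|[set f : {ffun 'I_m -> 'I_m.+1 * bool * bool} |
      ropart_ok f && (ropart_weight f == m)]|.

(* Main.v *)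
Require Import Defs.
From mathcomp Require Import all_boot all_order all_algebra.
From mathcomp Require Import zify ring.
Set Implicit Arguments. Unset Strict Implicit. Unset Printing Implicit Defensive.
Import Order.TTheory GRing.Theory Num.Theory.
Local Open Scope ring_scope.

(* Let phi and psi be Ramanujan's theta functions, f53(q) the sum of q^(4j^2+j)
   over all integers j, and q = x^2.  The recurrence says that
   V(x) (phi(-x) + phi(-q)) = 2.  Splitting phi(-x) by parity gives
   phi(-x) + phi(-q) = E(q) - x T(q) with E = phi(q^2) + phi(-q) and
   T = 2 psi(q^4).  Reindexing double series gives phi(-q)^2 = phi(q^2)^2 - q T^2
   and, using phi(-q) psi(q) = phi(-q^2) psi(-q), also psi(q) E = 2 f53(q)^2.
   If O and W are the two overpartition series, the triple product turns these
   into O phi(-q) = 1 and W phi(-q) E = T, from which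
   (O + x W) (E - x T) = 2 follows, hence V(x) = O(x^2) + x W(x^2).

   Power series are replaced by a commutative ring in which x is nilpotent
   (finally Z[X]/(X^n)), so that an infinite product or sum is literally a
   sufficiently long finite one. *)

(** * Preliminaries: nilpotent elements, stable products, reindexing of sums *)

Lemma exp_nilpotent (R : pzRingType) (q : R) N (qN : q ^+ N = 0) n : (N <= n)%N -> q ^+ n = 0.
Proof. by move=> h; rewrite -(subnK h) exprD qN mulr0. Qed.

Lemma geometricV (R : pzRingType) (y : R) n : y ^+ n = 0 -> (1 - y) * \sum_(i < n) y ^+ i = 1.
Proof. by move=> yn; rewrite -opprB mulNr -subrX1 yn sub0r opprK. Qed.

Lemma mulI_of_inv (R : comPzRingType) (y z a b : R) : y * z = 1 -> y * a = y * b -> a = b.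
Proof. by move=> yz e; rewrite -[a]mul1r -yz mulrAC e mulrAC yz mul1r. Qed.

Lemma prod_tail (R : comNzRingType) (N : nat) (g : nat -> R) n :
  (N <= n)%N -> (forall k, (N <= k)%N -> g k = 1) ->
  \prod_(k < n) g k = \prod_(k < N) g k.
Proof.
move=> Nn g1; rewrite -(subnKC Nn); elim: (n - N)%N => [|d IH]; first by rewrite addn0.
by rewrite addnS big_ord_recr /= IH g1 ?mulr1 // leq_addr.
Qed.

(** This serves changes of variables in truncated theta sums. The substitution does not map one box
    onto the other, but terms falling outside vanish by nilpotency, so only nonzero terms have to
    correspond. *)
Lemma big_reindex_supp (V : nmodType) (I J : eqType) (s : seq I) (t : seq J)
    (P : pred I) (F : I -> V) (G : J -> V) (h : J -> I) (h' : I -> J) :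
  uniq s -> uniq t -> cancel h h' -> (forall j, P (h j)) ->
  (forall i, P i -> h (h' i) = i) -> (forall j, F (h j) = G j) ->
  (forall j, G j != 0 -> j \in t /\ h j \in s) ->
  \sum_(i <- s | P i) F i = \sum_(j <- t) G j.
Proof.
move=> us ut hK Ph h'K FG supp.
rewrite (bigID (fun i => F i == 0)) /= big1 ?add0r => [|i /andP[_ /eqP] //].
rewrite [RHS](bigID (fun j => G j == 0)) /= [X in _ = X + _]big1 ?add0r => [|j /eqP //].
rewrite -big_filter -[RHS]big_filter.
have pm : perm_eq [seq i <- s | P i && (F i != 0)] [seq h j | j <- t & G j != 0].
  apply: uniq_perm; rewrite ?(map_inj_uniq (can_inj hK)) ?filter_uniq // => i.
  rewrite mem_filter; apply/idP/mapP => [/andP[/andP[Pi Fi] si]|[j]].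
    have Gi : G (h' i) != 0 by rewrite -FG h'K.
    by exists (h' i); rewrite ?mem_filter ?Gi ?h'K //; case: (supp _ Gi).
  by rewrite mem_filter => /andP[Gj tj] ->; rewrite Ph FG Gj; case: (supp _ Gj).
by rewrite (perm_big _ pm) big_map; apply: eq_bigr.
Qed.

(* j (j + 1) / 2 *)
Definition tri (j : int) : nat := match j with Posz n | Negz n => 'C(n.+1, 2) end.

Lemma triE j : (tri j)%:Z * 2 = j * (j + 1).
Proof.
have binE n : ('C(n.+1, 2))%:Z * 2 = n%:Z * (n%:Z + 1).
  by elim: n => [|n IH] //; rewrite binS bin1 PoszD mulrDl IH; lia.
by case: j => n /=; rewrite binE // NegzE; lia.
Qed.

(** Presented as a shift of 0..2L, the index range of the finite triple product with L factors of
    each kind. *)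
Definition box (L : nat) : seq int := [seq l%:Z - L%:Z | l <- index_iota 0 L.*2.+1].

Lemma mem_box L (j : int) : (j \in box L) = (`|j|%N <= L)%N.
Proof.
apply/mapP/idP => [[l]|jL]; first by rewrite mem_index_iota => /andP[_ h] ->; lia.
by exists (absz (j + L%:Z)); rewrite ?mem_index_iota; lia.
Qed.

Lemma box_uniq L : uniq (box L).
Proof. by rewrite map_inj_uniq ?iota_uniq // => i j; lia. Qed.

(** * The Jacobi triple product, through its finite form *)

Section TripleProduct.
Variables (R : comNzRingType) (N : nat) (A B : R).
Let Q := A * B.
Hypothesis QN : Q ^+ N = 0.

Let Q0 n : (N <= n)%N -> Q ^+ n = 0 := exp_nilpotent QN (n := n).

Definition qfact n := \prod_(k < n) (1 - Q ^+ k.+1).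
Definition qfactV n := \prod_(k < n) \sum_(i < N) (Q ^+ k.+1) ^+ i.

Lemma qfactK n : qfact n * qfactV n = 1.
Proof.
rewrite -big_split big1 //= => k _; apply: geometricV.
by rewrite -exprM Q0 // leq_pmull.
Qed.

Lemma qfactS n : qfact n.+1 = qfact n * (1 - Q ^+ n.+1).
Proof. by rewrite /qfact big_ord_recr. Qed.

Lemma qfactVS n : qfactV n = qfactV n.+1 * (1 - Q ^+ n.+1).
Proof.
rewrite /qfactV big_ord_recr /= -mulrA [X in _ * X]mulrC geometricV ?mulr1 //.
by rewrite -exprM Q0 // leq_pmull.
Qed.

Lemma qfact_stable n : (N <= n)%N -> qfact n = qfact N.
Proof.
move=> h; rewrite -(subnKC h); elim: (n - N)%N => [|d IH]; first by rewrite addn0.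
by rewrite addnS qfactS IH Q0 ?subr0 ?mulr1 // -addnS leq_addr.
Qed.

Lemma qfactV_stable n : (N <= n)%N -> qfactV n = qfactV N.
Proof.
by move=> h; rewrite -[LHS]mulr1 -(qfactK N) mulrA -(qfact_stable h)
  [_ * qfact n]mulrC qfactK mul1r.
Qed.

Lemma qfactV0 : qfactV 0 = 1. Proof. exact: big_ord0. Qed.

(* Gaussian binomial (a + b choose a)_Q: qfactV is the inverse of qfact *)
Definition qbin a b := qfact (a + b) * qfactV a * qfactV b.

Lemma qbin0 b : qbin 0 b = 1.
Proof. by rewrite /qbin qfactV0 mulr1 qfactK. Qed.

Lemma qbinn a : qbin a 0 = 1.
Proof. by rewrite /qbin addn0 qfactV0 mulr1 qfactK. Qed.

Lemma qbin_pascal a b :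
  qbin a.+1 b.+1 = qbin a.+1 b + Q ^+ b.+1 * qbin a b.+1.
Proof.
have e : Q ^+ (a + b).+2 = Q ^+ a.+1 * Q ^+ b.+1 by rewrite -exprD addSn addnS.
by rewrite /qbin !addSn !addnS (qfactS (a + b).+1) e (qfactVS b) (qfactVS a); ring.
Qed.

Lemma qbin_pascalV a b :
  qbin a.+1 b.+1 = Q ^+ a.+1 * qbin a.+1 b + qbin a b.+1.
Proof.
have e : Q ^+ (a + b).+2 = Q ^+ a.+1 * Q ^+ b.+1 by rewrite -exprD addSn addnS.
by rewrite /qbin !addSn !addnS (qfactS (a + b).+1) e (qfactVS b) (qfactVS a); ring.
Qed.

(** The first Pascal rule in summed form: it absorbs one more factor of the finite product. The
    companion [sum_qbinSV] does the same with the second rule. *)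
Lemma sum_qbinS s (t : nat -> R) :
  \sum_(l < s.+2) qbin l (s.+1 - l) * t l
  = \sum_(l < s.+1) qbin l (s - l) * (t l + Q ^+ (s - l) * t l.+1).
Proof.
under [RHS]eq_bigr do rewrite mulrDr mulrA.
rewrite big_split big_ord_recl big_ord_recr.
rewrite [X in _ = X + _]big_ord_recl [X in _ = _ + X]big_ord_recr /=.
rewrite /bump /= !subnn !subn0 !qbin0 !qbinn !add1n expr0 !mul1r -!addrA; congr (_ + _).
rewrite addrA; congr (_ + _); rewrite -big_split; apply: eq_bigr => i _ /=.
rewrite !add1n subSS.
have -> : (s - i = (s - i.+1).+1)%N by have := ltn_ord i; lia.
by rewrite qbin_pascal /=; ring.
Qed.

Lemma sum_qbinSV s (t : nat -> R) :
  \sum_(l < s.+2) qbin l (s.+1 - l) * t l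
  = \sum_(l < s.+1) qbin l (s - l) * (Q ^+ l * t l + t l.+1).
Proof.
under [RHS]eq_bigr do rewrite mulrDr mulrA.
rewrite big_split big_ord_recl big_ord_recr.
rewrite [X in _ = X + _]big_ord_recl [X in _ = _ + X]big_ord_recr /=.
rewrite /bump /= !subnn !subn0 !qbin0 !qbinn !add1n expr0 !mul1r -!addrA; congr (_ + _).
rewrite addrA; congr (_ + _); rewrite -big_split; apply: eq_bigr => i _ /=.
rewrite !add1n subSS.
have -> : (s - i = (s - i.+1).+1)%N by have := ltn_ord i; lia.
by rewrite qbin_pascalV /=; ring.
Qed.

(** The general term of Ramanujan's f(A, B). *)
Definition theta_term (j : int) := A ^+ tri j * B ^+ tri (j - 1).

Lemma theta_termS (j : int) (n d : nat) : n%:Z = j + d%:Z ->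
  A * Q ^+ n * theta_term j = Q ^+ d * theta_term (j + 1).
Proof.
move=> h; rewrite /theta_term addrK /Q !exprMn.
have h1 := triE j; have h2 := triE (j + 1); have h3 := triE (j - 1).
have e1 : (n.+1 + tri j = d + tri (j + 1))%N by nia.
have e2 : (n + tri (j - 1) = d + tri j)%N by nia.
transitivity (A ^+ (n.+1 + tri j) * B ^+ (n + tri (j - 1))); first by rewrite !exprD exprS; ring.
by rewrite e1 e2 !exprD; ring.
Qed.

Lemma theta_termP (j : int) (n l : nat) : l%:Z = j + n%:Z ->
  B * Q ^+ n * theta_term j = Q ^+ l * theta_term (j - 1).
Proof.
move=> h; rewrite /theta_term /Q !exprMn.
have h1 := triE j; have h2 := triE (j - 1 - 1); have h3 := triE (j - 1).
have e1 : (n + tri j = l + tri (j - 1))%N by nia.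
have e2 : (n.+1 + tri (j - 1) = l + tri (j - 1 - 1))%N by nia.
transitivity (A ^+ (n + tri j) * B ^+ (n.+1 + tri (j - 1))); first by rewrite !exprD exprS; ring.
by rewrite e1 e2 !exprD; ring.
Qed.

(** Induction on [n] with [m = 0], then on [m]. A new factor in B shifts j down and uses the second
    Pascal rule; a new factor in A shifts j up and uses the first. *)
Lemma finite_triple_product m n :
  \prod_(k < m) (1 + A * Q ^+ k) * \prod_(k < n) (1 + B * Q ^+ k)
  = \sum_(l < (m + n).+1) qbin l (m + n - l) * theta_term (l%:Z - n%:Z).
Proof.
elim: m => [|m IH].
  rewrite big_ord0 mul1r add0n; elim: n => [|n IH].
    by rewrite big_ord0 big_ord_recl big_ord0 qbin0 /theta_term /= !expr0 !mulr1 addr0.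
  rewrite big_ord_recr /= IH mulrC big_distrr.
  rewrite (sum_qbinSV n (fun l => theta_term (l%:Z - n.+1%:Z))); apply: eq_bigr => l _ /=.
  have -> : l.+1%:Z - n.+1%:Z = l%:Z - n%:Z by lia.
  have -> : l%:Z - n.+1%:Z = (l%:Z - n%:Z) - 1 by lia.
  by rewrite -(@theta_termP _ n) ?subrK //; ring.
rewrite big_ord_recr /= mulrAC IH mulrC big_distrr addSn.
rewrite (sum_qbinS (m + n) (fun l => theta_term (l%:Z - n%:Z))); apply: eq_bigr => l _ /=.
have -> : l.+1%:Z - n%:Z = (l%:Z - n%:Z) + 1 by lia.
rewrite -(@theta_termS _ m) //; first by ring.
by have := ltn_ord l; lia.
Qed.

Lemma triple_product L : (N.*2.+2 <= L)%N ->
  \prod_(k < L) (1 - Q ^+ k.+1) * \prod_(k < L) (1 + A * Q ^+ k)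
    * \prod_(k < L) (1 + B * Q ^+ k)
  = \sum_(j <- box L) theta_term j.
Proof.
move=> hL; rewrite -mulrA finite_triple_product addnn big_distrr /=.
rewrite /box big_map big_mkord; apply: eq_bigr => l _.
set j : int := l%:Z - L%:Z.
(* In the middle range the Gaussian binomial has stabilised to the inverse of [qfact N], which the
   prefactor cancels. Near the ends |j| is so large that the term contains Q^N = 0. *)
have [small|big] := boolP ((N <= l)%N && (N <= L.*2 - l)%N).
  move: small => /andP[h1 h2]; have el : (l + (L.*2 - l) = L.*2)%N by have := ltn_ord l; lia.
  rewrite /qbin el (qfactV_stable h1) (qfactV_stable h2) -/(qfact L).
  have -> : qfact L = qfact N by apply: qfact_stable; lia.
  have -> : qfact L.*2 = qfact N by apply: qfact_stable; lia.
  by rewrite qfactK mul1r mulrA qfactK mul1r.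
suff -> : theta_term j = 0 by rewrite !mulr0.
have h1 := triE j; have h3 := triE (j - 1).
have := ltn_ord l => hl.
have [hA hB] : (N <= tri j)%N /\ (N <= tri (j - 1))%N.
  have hj : (N.+2 <= `|j|)%N by rewrite /j; lia.
  by split; nia.
by rewrite /theta_term -(subnKC hA) -(subnKC hB) !exprD mulrACA -exprMn QN mul0r.
Qed.

End TripleProduct.

(** * Theta functions and their infinite products *)

Section Theta.
Variables (R : comNzRingType) (N L : nat).
Hypothesis NL : (N.*2.+2 <= L)%N.

(** The q-Pochhammer symbol (-s q^r; q^M) with L factors. *)
Definition qprod (q s : R) (M r : nat) := \prod_(k < L) (1 + s * q ^+ (M * k + r)).

(* With exponents tri j and tri (j - 1), theta q 1 a b is Ramanujan's f(q^a, q^b);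
   for s = -1 it is f(-q^a, -q^b), since |j| and tri j + tri (j - 1) = j^2 have the
   same parity. *)
Definition theta (q s : R) (a b : nat) :=
  \sum_(j <- box L) s ^+ `|j|%N * q ^+ (a * tri j + b * tri (j - 1)).

Section Products.
Variable q : R.
Hypothesis qN : q ^+ N = 0.

Lemma prod_parity (g : nat -> R) : (forall k, (N <= k)%N -> g k = 1) ->
  \prod_(k < L) g k = \prod_(k < L) g (2 * k)%N * \prod_(k < L) g (2 * k + 1)%N.
Proof.
move=> g1; have -> : \prod_(k < L) g k = \prod_(k < 2 * L) g k.
  by rewrite (prod_tail _ g1) ?[RHS](prod_tail _ g1) //; lia.
rewrite -big_split; elim: L => [|n IH]; first by rewrite muln0 !big_ord0.
by rewrite mulnS add2n !big_ord_recr /= IH addn1 mulrA.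
Qed.

Lemma qprod_parity s M r : (0 < M)%N ->
  qprod q s M r = qprod q s (2 * M) r * qprod q s (2 * M) (M + r).
Proof.
move=> M0; rewrite /qprod (prod_parity (g := fun k => 1 + s * q ^+ (M * k + r))).
  by congr (_ * _); apply: eq_bigr => k _; congr (1 + s * q ^+ _); lia.
by move=> k Nk; rewrite (exp_nilpotent qN) ?mulr0 ?addr0 //; nia.
Qed.

Lemma qprod_square M r : qprod q 1 M r * qprod q (-1) M r = qprod q (-1) (2 * M) (2 * r).
Proof.
rewrite -big_split; apply: eq_bigr => k _ /=.
have -> : (2 * M * k + 2 * r = (M * k + r) + (M * k + r))%N by lia.
by rewrite [q ^+ (_ + (_ + r))]exprD; ring.
Qed.

Lemma qprod_inv s M r : (0 < r)%N -> exists y, qprod q s M r * y = 1.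
Proof.
move=> r0; exists (\prod_(k < L) \sum_(i < N) (- (s * q ^+ (M * k + r))) ^+ i).
rewrite -big_split big1 //= => k _; rewrite -{1}[s * _]opprK geometricV //.
by rewrite -mulNr exprMn -exprM (exp_nilpotent qN) ?mulr0 //; nia.
Qed.

(* Euler: partitions into distinct parts against partitions into odd parts *)
Lemma qprod_euler M : (0 < M)%N -> qprod q 1 M M * qprod q (-1) (2 * M) M = 1.
Proof.
move=> M0; have [|y yP] := @qprod_inv (-1) (2 * M) (2 * M); first by lia.
apply: (mulI_of_inv yP); rewrite mulr1 -[in RHS]qprod_square.
by rewrite (@qprod_parity (-1) M M M0) addnn -mul2n; ring.
Qed.

(** The triple product at A = s q^a, B = s q^b, where the sign drops out of AB = q^(a+b). *)
Lemma theta_prod s a b : s * s = 1 -> (0 < a + b)%N ->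
  theta q s a b = qprod q (-1) (a + b) (a + b) * qprod q s (a + b) a * qprod q s (a + b) b.
Proof.
move=> ss ab0.
have QN : (s * q ^+ a) * (s * q ^+ b) = q ^+ (a + b) by rewrite mulrACA ss mul1r exprD.
have QN0 : ((s * q ^+ a) * (s * q ^+ b)) ^+ N = 0.
  by rewrite QN -exprM (exp_nilpotent qN) //; nia.
have s2 i : s ^+ (2 * i) = 1 by rewrite exprM expr2 ss expr1n.
transitivity (\sum_(j <- box L) theta_term (s * q ^+ a) (s * q ^+ b) j).
  apply: eq_bigr => j _; rewrite /theta_term !exprMn mulrACA -!exprM -!exprD; congr (_ * _).
  have h1 := triE j; have h2 := triE (j - 1).
  have e : (tri j + tri (j - 1) = `|j| * `|j|)%N by nia.
  rewrite e; case: `|j|%N => // n; rewrite mulSn exprD.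
  have [k ->] : exists k, (n * n.+1 = 2 * k)%N by exists (tri n); have := triE n; lia.
  by rewrite s2 mulr1.
rewrite -(triple_product QN0 NL) QN.
congr (_ * _ * _); apply: eq_bigr => k _.
- by rewrite mulN1r -exprM; congr (1 - q ^+ _); lia.
- by rewrite -exprM -mulrA -exprD addnC.
- by rewrite -exprM -mulrA -exprD addnC.
Qed.

End Products.

(** * Theta identities by reindexing simple and double series *)

(** A term survives only if its exponent is below N; this bound and the next then keep the surviving
    indices inside the box. *)
Lemma tri_ge (j : int) : (`|j| <= (tri j).+1)%N.
Proof. by have := triE j; nia. Qed.

Lemma tri_addP (j : int) : (`|j| <= tri j + tri (j - 1))%N.
Proof. by have := triE j; have := triE (j - 1); nia. Qed.

Lemma tri_double (j : int) :
  (tri (2 * j)%R + tri (2 * j - 1)%R = 4 * (tri j + tri (j - 1)%R))%N.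
Proof.
have h1 := triE j; have h2 := triE (j - 1).
by have h3 := triE (2 * j); have h4 := triE (2 * j - 1); lia.
Qed.

Lemma tri_doubleS (j : int) :
  (tri (2 * j + 1)%R + tri (2 * j + 1 - 1)%R = (8 * tri j).+1)%N.
Proof.
have h1 := triE j; have h2 := triE (2 * j + 1).
by have h3 := triE (2 * j + 1 - 1); lia.
Qed.

Section Series.
Variable q : R.
Hypothesis qN : q ^+ N = 0.

Lemma expr_supp (c : R) e : c * q ^+ e != 0 -> (e < N)%N.
Proof. by rewrite ltnNge; apply: contra_neqN => /(exp_nilpotent qN) ->; rewrite mulr0. Qed.

Definition box2 := [seq (i, j) | i <- box L, j <- box L].

Lemma mem_box2 (p : int * int) : (p \in box2) = (`|p.1|%N <= L)%N && (`|p.2|%N <= L)%N.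
Proof.
rewrite -!mem_box; apply/allpairsP/andP => [[[i j] [? ? ->]]|[h1 h2]] //.
by exists p; case: p h1 h2.
Qed.

Lemma box2_uniq : uniq box2.
Proof. by apply: allpairs_uniq; rewrite ?box_uniq // => -[? ?] [? ?]. Qed.

Lemma mul_theta s a b s' c d : theta q s a b * theta q s' c d =
  \sum_(p <- box2) s ^+ `|p.1|%N * s' ^+ `|p.2|%N
     * q ^+ ((a * tri p.1 + b * tri (p.1 - 1)) + (c * tri p.2 + d * tri (p.2 - 1))).
Proof.
rewrite big_allpairs big_distrlr; apply: eq_bigr => i _; apply: eq_bigr => j _ /=.
by rewrite mulrACA -exprD.
Qed.

(** This is psi(q) phi(q^2) + psi(-q) phi(-q^2) = 2 f53(q)^2. Pairs (i, k) with i + k odd cancel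
    between the two products and the others double; i = m + n, k = m - n then gives 2i^2 + i + 2k^2
    = (4m^2 + m) + (4n^2 + n). *)
Lemma theta_addition :
  theta q 1 3 1 * theta q 1 2 2 + theta q (-1) 3 1 * theta q (-1) 2 2
  = 2 * theta q 1 5 3 ^+ 2.
Proof.
rewrite expr2 !mul_theta -big_split.
rewrite (bigID (fun p : int * int => odd (absz (p.1 + p.2)))) /= big1 ?add0r => [|p op]; last first.
  have -> : (-1 : R) ^+ `|p.1|%N * (-1) ^+ `|p.2|%N = -1.
    by rewrite -exprD -signr_odd; have -> : odd (`|p.1| + `|p.2|) by lia.
  by rewrite !expr1n; ring.
under eq_bigr => p op.
  have -> : (-1 : R) ^+ `|p.1|%N * (-1) ^+ `|p.2|%N = 1.
    rewrite -exprD -signr_odd; have -> // : odd (`|p.1| + `|p.2|) = false by lia.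
  rewrite !expr1n !mul1r -mulr2n -mulr_natl.
  over.
rewrite -big_distrr /=; congr (_ * _).
apply: (@big_reindex_supp _ _ _ _ _ _ _ _ (fun p : int * int => (p.1 + p.2, p.1 - p.2))
          (fun p : int * int => (((p.1 + p.2) %/ 2)%Z, ((p.1 - p.2) %/ 2)%Z))).
- exact: box2_uniq.
- exact: box2_uniq.
- by move=> [m n] /=; congr pair; lia.
- by move=> [m n] /=; lia.
- by move=> [m n] /= e; congr pair; lia.
- move=> [m n] /=; rewrite !expr1n !mul1r; congr (q ^+ _).
  have := triE m; have := triE n; have := triE (m - 1); have := triE (n - 1).
  have := triE (m + n); have := triE (m - n); have := triE (m + n - 1); have := triE (m - n - 1).
  nia.
- move=> [m n] /= /expr_supp e; rewrite !mem_box2 /=.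
  by have := tri_addP m; have := tri_addP n; lia.
Qed.

(** The exponent i^2 + k^2 is split by the parity of i + k: i = m + n, k = m - n gives 2m^2 + 2n^2,
    while i = m + n + 1, k = m - n gives 1 + 4 tri m + 4 tri n with sign -1. *)
Lemma theta_square :
  theta q (-1) 1 1 ^+ 2 = theta q 1 2 2 ^+ 2 - q * theta q 1 4 0 ^+ 2.
Proof.
rewrite !expr2 !mul_theta.
rewrite (bigID (fun p : int * int => odd (absz (p.1 + p.2)))) /= addrC; congr (_ + _).
  apply: (@big_reindex_supp _ _ _ _ _ _ _ _ (fun p : int * int => (p.1 + p.2, p.1 - p.2))
          (fun p : int * int => (((p.1 + p.2) %/ 2)%Z, ((p.1 - p.2) %/ 2)%Z))).
  - exact: box2_uniq.
  - exact: box2_uniq.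
  - by move=> [m n] /=; congr pair; lia.
  - by move=> [m n] /=; lia.
  - by move=> [m n] /= e; congr pair; lia.
  - move=> [m n] /=; rewrite !expr1n !mul1r -exprD -signr_odd.
    have -> : odd (absz (m + n) + absz (m - n)) = false by lia.
    rewrite expr0 mul1r; congr (q ^+ _).
    have := triE m; have := triE n; have := triE (m - 1); have := triE (n - 1).
    have := triE (m + n); have := triE (m - n); have := triE (m + n - 1); have := triE (m - n - 1).
    nia.
  - move=> [m n] /= /expr_supp e; rewrite !mem_box2 /=.
    by have := tri_addP m; have := tri_addP n; lia.
rewrite big_distrr -sumrN /=.
apply: (@big_reindex_supp _ _ _ _ _ _ _ _ (fun p : int * int => (p.1 + p.2 + 1, p.1 - p.2))
        (fun p : int * int => (((p.1 + p.2 - 1) %/ 2)%Z, ((p.1 - p.2 - 1) %/ 2)%Z))).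
- exact: box2_uniq.
- exact: box2_uniq.
- by move=> [m n] /=; congr pair; lia.
- by move=> [m n] /=; lia.
- by move=> [m n] /= e; congr pair; lia.
- move=> [m n] /=; rewrite !expr1n !mul1r -exprD -signr_odd.
  have -> : odd (absz (m + n + 1)%R + absz (m - n)) by lia.
  rewrite mulN1r -exprS; congr (- q ^+ _).
  have := triE m; have := triE n.
  have := triE (m + n + 1); have := triE (m - n); have := triE (m + n + 1 - 1).
  have := triE (m - n - 1).
  nia.
- move=> [m n] /=; rewrite !expr1n !mul1r -exprS -(mulN1r (q ^+ _)) => /expr_supp e; rewrite !mem_box2 /=.
  by have := tri_ge m; have := tri_ge n; lia.
Qed.

(** Even indices contribute x^(4j^2) = q^(2j^2), odd ones -x^((2j+1)^2) = -x q^(4 tri j). *)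
Lemma theta_even_odd (x : R) : x ^+ 2 = q ->
  theta x (-1) 1 1 = theta q 1 2 2 - x * theta q 1 4 0.
Proof.
move=> xq; rewrite /theta (bigID (fun j : int => odd (absz j))) /= addrC; congr (_ + _).
  apply: (@big_reindex_supp _ int int _ _ _ _ _ (fun j : int => 2 * j) (fun j : int => (j %/ 2)%Z)).
  - exact: box_uniq.
  - exact: box_uniq.
  - by move=> j /=; lia.
  - by move=> j /=; lia.
  - by move=> j /= e; lia.
  - move=> j /=; rewrite expr1n mul1r -signr_odd -xq -exprM.
    have -> : odd (absz (2 * j)) = false by lia.
    rewrite expr0 mul1r; congr (x ^+ _).
    by rewrite !mul1n tri_double; lia.
  - move=> j /= /expr_supp e; rewrite !mem_box.
    by have := tri_addP j; lia.
rewrite big_distrr -sumrN /=.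
apply: (@big_reindex_supp _ int int _ _ _ _ _ (fun j : int => 2 * j + 1) (fun j : int => ((j - 1) %/ 2)%Z)).
- exact: box_uniq.
- exact: box_uniq.
- by move=> j /=; lia.
- by move=> j /=; lia.
- by move=> j /= e; lia.
- move=> j /=; rewrite expr1n mul1r -signr_odd -xq -exprM.
  have -> : odd (absz (2 * j + 1)%R) by lia.
  rewrite mulN1r -exprS; congr (- x ^+ _).
  by rewrite !mul1n tri_doubleS; lia.
- move=> j /=; rewrite expr1n mul1r -mulNr => /expr_supp e; rewrite !mem_box.
  by have := tri_ge j; lia.
Qed.

(* The quotients phi(-q) / phi(-q^2) and psi(-q) / psi(q) coincide *)
Lemma theta_exchange :
  theta q (-1) 1 1 * theta q 1 3 1 = theta q (-1) 2 2 * theta q (-1) 3 1.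
Proof.
have N1 : (-1 : R) * -1 = 1 by rewrite mulrNN mulr1.
rewrite !(theta_prod qN) ?mulr1 //=.
have -> : qprod q (-1) 2 2 = qprod q (-1) 4 2 * qprod q (-1) 4 4 := @qprod_parity q qN (-1) 2 2 isT.
have Ho : qprod q (-1) 2 1 = qprod q (-1) 4 1 * qprod q (-1) 4 3 := @qprod_parity q qN (-1) 2 1 isT.
have Hp : qprod q 1 2 1 = qprod q 1 4 1 * qprod q 1 4 3 := @qprod_parity q qN 1 2 1 isT.
have Hs : qprod q 1 2 1 * qprod q (-1) 2 1 = qprod q (-1) 4 2 := qprod_square q 2 1.
transitivity (qprod q (-1) 4 2 * qprod q (-1) 4 4 * qprod q (-1) 2 1 * qprod q (-1) 4 4
  * (qprod q 1 2 1 * qprod q (-1) 2 1)); first by rewrite Hp; ring.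
by rewrite Hs Ho; ring.
Qed.

(** Gauss's product phi(-q) = (q;q) / (-q;q), the reciprocal of the overpartition series. *)
Lemma theta_phi_prod : theta q (-1) 1 1 * qprod q 1 1 1 = qprod q (-1) 1 1.
Proof.
rewrite (theta_prod qN) ?mulrNN ?mulr1 //=.
have E : qprod q 1 1 1 * qprod q (-1) 2 1 = 1 := @qprod_euler q qN 1 isT.
have -> : qprod q (-1) 1 1 = qprod q (-1) 2 1 * qprod q (-1) 2 2 := @qprod_parity q qN (-1) 1 1 isT.
transitivity (qprod q (-1) 2 1 * qprod q (-1) 2 2 * (qprod q 1 1 1 * qprod q (-1) 2 1)); first by ring.
by rewrite E mulr1.
Qed.

Lemma qprod_r0 M : (0 < M)%N -> qprod q 1 M 0 = 2 * qprod q 1 M M.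
Proof.
move=> M0; rewrite /qprod; have -> : L = L.-1.+1 by lia.
rewrite big_ord_recl [in RHS]big_ord_recr /= muln0 addn0 expr0 mulr1.
(* The left product starts with the factor 2; the right one ends with 1 + q^(ML) = 1. The remaining
   factors agree after a shift of k. *)
rewrite [q ^+ _](exp_nilpotent qN); last by nia.
rewrite mulr0 addr0 mulr1; congr (_ * _); apply: eq_bigr => k _.
by rewrite /bump /= add1n mulnS addn0 addnC.
Qed.

(* w stands for the generating function of the restricted overpartitions *)
Lemma theta_restricted (w : R) :
  w * qprod q (-1) 1 1 = qprod q 1 2 2 * qprod q 1 8 1 ^+ 2 * qprod q 1 8 7 ^+ 2 ->
  2 * (w * theta q 1 5 3 ^+ 2 * theta q (-1) 1 1) = theta q 1 3 1 * theta q 1 4 0.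
Proof.
(* Multiplication by the unit (-q;q) turns phi(-q) into (q;q), so that the hypothesis on [w]
   applies; what remains is a comparison of products over residue classes modulo 8. *)
move=> wE; have [|y yP] := @qprod_inv q qN 1 1 1; first by [].
apply: (mulI_of_inv yP).
have -> : qprod q 1 1 1 * (2 * (w * theta q 1 5 3 ^+ 2 * theta q (-1) 1 1))
  = 2 * (w * (theta q (-1) 1 1 * qprod q 1 1 1)) * theta q 1 5 3 ^+ 2 by ring.
rewrite theta_phi_prod wE !(theta_prod qN) ?mulr1 //= qprod_r0 //.
have E1 : qprod q 1 1 1 = qprod q 1 2 1 * qprod q 1 2 2 := @qprod_parity q qN 1 1 1 isT.
have E2 : qprod q 1 2 1 = qprod q 1 4 1 * qprod q 1 4 3 := @qprod_parity q qN 1 2 1 isT.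
have E3 : qprod q 1 4 1 = qprod q 1 8 1 * qprod q 1 8 5 := @qprod_parity q qN 1 4 1 isT.
have E4 : qprod q 1 4 3 = qprod q 1 8 3 * qprod q 1 8 7 := @qprod_parity q qN 1 4 3 isT.
have E5 : qprod q 1 4 4 * qprod q (-1) 4 4 = qprod q (-1) 8 8 := qprod_square q 4 4.
transitivity (2 * qprod q 1 2 2 * (qprod q (-1) 8 8 * qprod q 1 2 1) ^+ 2).
  by rewrite E2 E3 E4; ring.
by rewrite E1 -E5 E2; ring.
Qed.

End Series.
End Theta.

(** * Product formulas for the overpartition generating functions *)

Section Overpartitions.
Variables (R : comNzRingType) (m L : nat) (q : R).
Hypothesis qm : q ^+ m.+1 = 0.
Hypothesis mL : (m < L)%N.

Lemma qprod_trunc s : qprod L q s 1 1 = \prod_(k < m) (1 + s * q ^+ k.+1).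
Proof.
rewrite /qprod (@prod_tail _ m (fun k => 1 + s * q ^+ (1 * k + 1)%N)) ?(ltnW mL) //.
  by apply: eq_bigr => k _; rewrite mul1n addn1.
by move=> k mk; rewrite mul1n addn1 (exp_nilpotent qm) ?mulr0 ?addr0.
Qed.

Lemma sum_parts (i : 'I_m) : (\sum_(a < m.+1) q ^+ (i.+1 * a)) * (1 - q ^+ i.+1) = 1.
Proof.
under eq_bigr do rewrite exprM.
rewrite mulrC geometricV // -exprM.
by apply: (exp_nilpotent qm); rewrite leq_pmull.
Qed.

(** No bound on the weight is imposed: weights above m contribute 0. *)
Definition opart_gf := \sum_(f : {ffun 'I_m -> 'I_m.+1 * bool}) q ^+ opart_weight f.

(** Distributivity makes the sum over [f] a product over part sizes k, with factor (1 + q^k) times a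
    geometric sum. Multiplicities up to m suffice for the latter to invert 1 - q^k, as q^(k(m+1)) =
    0. *)
Lemma opart_gf_prod : opart_gf * qprod L q (-1) 1 1 = qprod L q 1 1 1.
Proof.
rewrite !qprod_trunc.
have -> : opart_gf = \prod_(i < m) \sum_(c : 'I_m.+1 * bool) q ^+ (i.+1 * (c.1 + c.2)).
  by rewrite bigA_distr_bigA; apply: eq_bigr => f _; rewrite prodrXr.
rewrite -big_split; apply: eq_bigr => i _ /=; rewrite mulN1r mul1r.
rewrite -(pair_bigA _ (fun (a : 'I_m.+1) (b : bool) => q ^+ (i.+1 * (a + b)))) /=.
have -> : \sum_(a < m.+1) \sum_(b : bool) q ^+ (i.+1 * (a + b))
    = (\sum_(a < m.+1) q ^+ (i.+1 * a)) * (1 + q ^+ i.+1).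
  rewrite big_distrl; apply: eq_bigr => a _.
  by rewrite big_bool /= addn0 addn1 mulnS exprD; ring.
by rewrite mulrAC sum_parts mul1r.
Qed.

Definition ropart_gf :=
  \sum_(f : {ffun 'I_m -> 'I_m.+1 * bool * bool} | ropart_ok f) q ^+ ropart_weight f.

Definition overlined_factor (n : nat) : R :=
  if ~~ odd n then 1 + q ^+ n
  else if (n %% 8 == 1)%N || (n %% 8 == 7)%N then (1 + q ^+ n) ^+ 2 else 1.

Lemma overlined_factor_trunc k : (m <= k)%N -> overlined_factor k.+1 = 1.
Proof.
move=> mk; rewrite /overlined_factor (exp_nilpotent qm) //.
by rewrite addr0 expr1n !if_same.
Qed.

Lemma ropart_gf_trunc :
  ropart_gf * qprod L q (-1) 1 1 = \prod_(k < L) overlined_factor k.+1.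
Proof.
rewrite qprod_trunc (@prod_tail _ m (fun k => overlined_factor k.+1)) ?(ltnW mL) //; last first.
  exact: overlined_factor_trunc.
(* Admissibility is a separate condition on each part size, so the restricted sum still factors over
   the sizes. *)
pose ok (i : 'I_m) (c : 'I_m.+1 * bool * bool) :=
  if ~~ odd i.+1 then ~~ c.2
  else if (i.+1 %% 8 == 1)%N || (i.+1 %% 8 == 7)%N then true else ~~ c.1.2 && ~~ c.2.
have -> : ropart_gf = \prod_(i < m) \sum_(c | ok i c) q ^+ (i.+1 * (c.1.1 + c.1.2 + c.2)).
  rewrite bigA_distr_big_dep; apply: eq_big => [f|f _]; last by rewrite prodrXr.
  by apply/forallP/familyP.
rewrite -big_split; apply: eq_bigr => i _ /=; rewrite mulN1r.
have -> : \sum_(c | ok i c) q ^+ (i.+1 * (c.1.1 + c.1.2 + c.2))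
  = (\sum_(a < m.+1) q ^+ (i.+1 * a)) * overlined_factor i.+1.
  rewrite big_mkcond /=.
  rewrite -(pair_bigA _ (fun (ab : 'I_m.+1 * bool) (d : bool) =>
     if ok i (ab, d) then q ^+ (i.+1 * (ab.1 + ab.2 + d)) else 0)) /=.
  rewrite -(pair_bigA _ (fun (a : 'I_m.+1) (b : bool) => \sum_(d : bool)
     if ok i (a, b, d) then q ^+ (i.+1 * (a + b + d)) else 0)) /=.
  rewrite big_distrl; apply: eq_bigr => a _ /=.
  rewrite !big_bool /ok /overlined_factor /= !addn0 !addn1.
  by case: (odd i) => /=; [|case: (_ || _) => /=]; rewrite !exprM ?exprS; move: (q ^+ i.+1) => y; ring.
by rewrite mulrAC sum_parts mul1r.
Qed.

(** The part sizes are split into the even ones and the classes 1, 3, 5, 7 modulo 8 by repeated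
    halving; classes 3 and 5 contribute 1. *)
Lemma ropart_gf_prod : (m.+1.*2.+2 <= L)%N -> ropart_gf * qprod L q (-1) 1 1
  = qprod L q 1 2 2 * qprod L q 1 8 1 ^+ 2 * qprod L q 1 8 7 ^+ 2.
Proof.
move=> hL; rewrite ropart_gf_trunc.
pose D M r := \prod_(k < L) overlined_factor (M * k + r).
have DE M r : (0 < M)%N -> (0 < r)%N -> D M r = D (2 * M)%N r * D (2 * M)%N (M + r)%N.
  move=> M0 r0; rewrite /D (prod_parity hL (g := fun k => overlined_factor (M * k + r))).
    by congr (_ * _); apply: eq_bigr => k _; congr overlined_factor; lia.
  move=> k mk; have -> : (M * k + r = (M * k + r).-1.+1)%N by lia.
  by apply: overlined_factor_trunc; nia.
have D2 : D 2 2 = qprod L q 1 2 2.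
  by apply: eq_bigr => k _; rewrite /overlined_factor oddD oddM mul1r.
have Dr r : odd r -> D 8 r = if (r %% 8 == 1)%N || (r %% 8 == 7)%N then qprod L q 1 8 r ^+ 2 else 1.
  move=> r_odd; transitivity
     (\prod_(k < L) if (r %% 8 == 1)%N || (r %% 8 == 7)%N then (1 + q ^+ (8 * k + r)) ^+ 2 else 1).
    by apply: eq_bigr => k _; rewrite /overlined_factor oddD oddM r_odd /= mulnC modnMDl.
  case: ifP => _; last by rewrite big1.
  by rewrite -prodrXl; apply: eq_bigr => k _; rewrite mul1r.
transitivity (D 1 1); first by apply: eq_bigr => k _; rewrite mul1n addn1.
have -> : D 1 1 = D 2 1 * D 2 2 by apply: DE.
rewrite D2.
have -> : D 2 1 = D 4 1 * D 4 3 by apply: DE.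
have -> : D 4 1 = D 8 1 * D 8 5 by apply: DE.
have -> : D 4 3 = D 8 3 * D 8 7 by apply: DE.
by rewrite !Dr //= mulr1 mul1r; ring.
Qed.

End Overpartitions.

(** * The recurrence as an identity between V and theta functions *)

Section Recurrence.
Variables (R : comNzRingType) (N L : nat) (x : R) (v : int -> int).
Hypothesis xN : x ^+ N = 0.
Hypothesis NL : (N <= L)%N.
Hypothesis v_neg : forall n : int, n < 0 -> v n = 0.

Definition gen (d : nat) := \sum_(n < N) (v (n%:Z - d%:Z))%:~R * x ^+ n.

(** Multiplication by x moves the top coefficient to x^N = 0, and the vacated bottom one is a value
    of [v] at a negative argument, hence 0. *)
Lemma gen_shift d : x ^+ d * gen 0 = gen d.
Proof.
elim: d => [|d IH]; first by rewrite mul1r.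
rewrite exprS -mulrA IH /gen; case: N xN => [|n] xn; first by rewrite !big_ord0 mulr0.
have v0 : v (0%:Z - d.+1%:Z) = 0 by apply: v_neg; lia.
rewrite big_ord_recr big_ord_recl /= v0 mulr0z mul0r add0r mulrDr.
rewrite [x * (_ * x ^+ n)]mulrCA -exprS xn mulr0 addr0 big_distrr; apply: eq_bigr => i _ /=.
rewrite mulrCA -exprS /bump /= add1n; congr ((v _)%:~R * _); lia.
Qed.

Lemma big_box (F : int -> R) :
  \sum_(j <- box L) F j = F 0 + \sum_(1 <= j < L.+1) (F j%:Z + F (- j%:Z)).
Proof.
rewrite big_split /=.
pose s := 0%Z :: [seq j%:Z | j <- index_iota 1 L.+1] ++ [seq - j%:Z | j <- index_iota 1 L.+1].
have pm : perm_eq (box L) s.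
  apply: uniq_perm => [|| j]; first exact: box_uniq.
    rewrite /s /= cat_uniq mem_cat !map_inj_uniq ?iota_uniq /=; try by move=> i k; lia.
    rewrite andbT; apply/andP; split.
      by apply/norP; split; apply/mapP => -[k]; rewrite mem_index_iota; lia.
    by apply/hasPn => _ /mapP[k + ->]; rewrite mem_index_iota => h;
      apply/mapP => -[l]; rewrite mem_index_iota; lia.
  rewrite mem_box inE mem_cat; apply/idP/or3P => [h|[/eqP->//|/mapP[k]|/mapP[k]]]; last first.
  - by rewrite mem_index_iota => h ->; lia.
  - by rewrite mem_index_iota => h ->; lia.
  have [j0|j0|->] := ltgtP j 0; last by constructor 1.
    by constructor 3; apply/mapP; exists `|j|%N; rewrite ?mem_index_iota; lia.
  by constructor 2; apply/mapP; exists `|j|%N; rewrite ?mem_index_iota; lia.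
by rewrite (perm_big _ pm) big_cons big_cat !big_map.
Qed.

Lemma theta_phiE (y : R) :
  theta L y (-1) 1 1 = 1 + 2 * \sum_(1 <= j < L.+1) (-1) ^+ j * y ^+ (j ^ 2).
Proof.
have te (j : int) : (1 * tri j + 1 * tri (j - 1)%R = `|j| ^ 2)%N.
  by have h1 := triE j; have h2 := triE (j - 1); nia.
transitivity (\sum_(j <- box L) (-1) ^+ `|j|%N * y ^+ (`|j|%N ^ 2)).
  by apply: eq_bigr => j _; rewrite te.
rewrite big_box /= mul1r big_distrr; congr (_ + _); apply: eq_bigr => j _ /=.
by rewrite abszN absz_nat; ring.
Qed.

Hypothesis v_rec : forall n : nat,
     v n%:Z + \sum_(1 <= j < n.+1)
        (-1) ^+ j * (v (n%:Z - (j ^ 2)%N%:Z) + v (n%:Z - (2 * j ^ 2)%N%:Z))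
     = (n == 0%N)%:R.

(** Half of phi(-x) + phi(-x^2) is 1 plus the sum of (-1)^j (x^(j^2) + x^(2j^2)) over j >= 1, whose
    product with V is 1 by the recurrence. *)
Lemma gen_mul_theta : (0 < N)%N ->
  gen 0 * (theta L x (-1) 1 1 + theta L (x ^+ 2) (-1) 1 1) = 2.
Proof.
move=> N0; rewrite !theta_phiE.
set S1 := \sum_(_ <= _ < _) _; set S2 := \sum_(_ <= _ < _) _.
suff h : gen 0 * (1 + (S1 + S2)) = 1.
  transitivity (2 * (gen 0 * (1 + (S1 + S2)))); first by ring.
  by rewrite h mulr1.
rewrite -big_split mulrDr mulr1 big_distrr /=.
under eq_bigr => j _.
  rewrite -mulrDr mulrCA -exprM mulrDr ![gen 0 * _]mulrC !gen_shift /gen -big_split big_distrr /=.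
  over.
rewrite exchange_big /gen -big_split /=.
transitivity (\sum_(n < N) (n == 0%N :> nat)%:R * x ^+ n); last first.
  rewrite -(prednK N0) big_ord_recl mulr1 big1 ?addr0 // => i _.
  by rewrite mul0r.
apply: eq_bigr => n _; rewrite -[(_ == _)%:R](rmorph_nat (intmul 1)) /=.
rewrite -v_rec subr0 rmorphD mulrDl; congr (_ + _).
(* For j > n both n - j^2 and n - 2j^2 are negative, so the terms beyond the range of the recurrence
   vanish. *)
rewrite rmorph_sum big_distrl /= (big_cat_nat (n := n.+1)) //=; last by have := ltn_ord n; lia.
rewrite [X in _ + X]big_nat_cond [X in _ + X]big1 ?addr0 => [|j /andP[h _]]; last first.
  by rewrite !v_neg ?mul0r ?addr0 ?mulr0 //; nia.
apply: eq_bigr => j _.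
by rewrite intrM rmorph_sign intrD; ring.
Qed.

End Recurrence.

(** * The parity dissection V(x) = O(x^2) + x W(x^2) *)

Section Dissection.
Variables (R : comNzRingType) (m : nat) (x : R) (v : int -> int).
Hypothesis two_reg : forall y : R, 2 * y = 0 -> y = 0.
Hypothesis xN : x ^+ (2 * m.+1) = 0.
Hypothesis v_neg : forall n : int, n < 0 -> v n = 0.
Hypothesis v_rec : forall n : nat,
     v n%:Z + \sum_(1 <= j < n.+1)
        (-1) ^+ j * (v (n%:Z - (j ^ 2)%N%:Z) + v (n%:Z - (2 * j ^ 2)%N%:Z))
     = (n == 0%N)%:R.

Lemma gen_dissection :
  gen (2 * m.+1) x v 0 = opart_gf m (x ^+ 2) + x * ropart_gf m (x ^+ 2).
Proof.
set q := x ^+ 2; have qm : q ^+ m.+1 = 0 by rewrite -exprM.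
pose L := (2 * m.+1).+2; have hL : (m.+1.*2.+2 <= L)%N by rewrite /L; lia.
have mL : (m < L)%N by rewrite /L; lia.
have xL : (2 * m.+1 <= L)%N by rewrite /L; lia.
have := gen_mul_theta xN xL v_neg v_rec isT.
rewrite (theta_even_odd hL qm (erefl q)) -/q.
have := opart_gf_prod qm mL; have := theta_restricted hL qm (ropart_gf_prod qm mL hL).
have := theta_phi_prod hL qm; have := theta_exchange hL qm.
have := theta_square hL qm; have := theta_addition hL qm.
(* These inverses make (q;q), f53(q) and psi(q) units. *)
have [iE iEP] := qprod_inv hL qm (-1) 1 (r := 1) isT.
have [i1 i1P] := qprod_inv hL qm (-1) 8 (r := 8) isT.
have [i2 i2P] := qprod_inv hL qm 1 8 (r := 5) isT.
have [i3 i3P] := qprod_inv hL qm 1 8 (r := 3) isT.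
have [i4 i4P] := qprod_inv hL qm (-1) 4 (r := 4) isT.
have [i5 i5P] := qprod_inv hL qm 1 4 (r := 3) isT.
have [i6 i6P] := qprod_inv hL qm 1 4 (r := 1) isT.
have FV : theta L q 1 5 3 * (i1 * i2 * i3) = 1.
  rewrite (theta_prod hL qm) ?mulr1 //=.
  transitivity ((qprod L q (-1) 8 8 * i1) * (qprod L q 1 8 5 * i2) * (qprod L q 1 8 3 * i3)).
    by ring.
  by rewrite i1P i2P i3P !mulr1.
have PV : theta L q 1 3 1 * (i4 * i5 * i6) = 1.
  rewrite (theta_prod hL qm) ?mulr1 //=.
  transitivity ((qprod L q (-1) 4 4 * i4) * (qprod L q 1 4 3 * i5) * (qprod L q 1 4 1 * i6)).
    by ring.
  by rewrite i4P i5P i6P !mulr1.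
move: (i1 * i2 * i3) FV (i4 * i5 * i6) PV
  => iF FV iP PV {i1 i2 i3 i4 i5 i6 i1P i2P i3P i4P i5P i6P}.
(* The rest is algebra in a commutative ring, with [F] = f53(q), [P] = psi(q), [Pm] = psi(-q), [A2]
   = phi(q^2), [A2m] = phi(-q^2), [A1] = phi(-q), [E1] = (q;q) and [E1'] = (-q;q). *)
move: (theta L q 1 5 3) FV (theta L q 1 3 1) PV => F FV P PV.
move: (theta L q 1 2 2) (theta L q (-1) 3 1) (theta L q (-1) 2 2) (theta L q (-1) 1 1)
  (theta L q 1 4 0) (qprod L q (-1) 1 1) iEP (qprod L q 1 1 1) (opart_gf m q) (ropart_gf m q)
  (gen _ _ _ _) => A2 Pm A2m A1 T E1 E1P E1' OP W V hadd hsq hex hphi hW hOP hV.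
have OPA : OP * A1 = 1.
  have e : OP * A1 * E1 = E1 by rewrite -mulrA [A1 * _]mulrC mulrA hOP mulrC.
  by rewrite -[LHS]mulr1 -E1P mulrA e.
pose E := A2 + A1.
have PE : P * E = 2 * F ^+ 2 by rewrite -hadd /E mulrDr [P * A1]mulrC hex; ring.
have WAE : W * A1 * E = T.
  apply: (mulI_of_inv PV); rewrite -hW.
  by transitivity (W * A1 * (P * E)); [ring | rewrite PE; ring].
have WE : W * E = OP * T.
  by rewrite -WAE -[W * E]mul1r -OPA; ring.
have E2 : E ^+ 2 - q * T ^+ 2 = 2 * A1 * E.
  have -> : q * T ^+ 2 = A2 ^+ 2 - A1 ^+ 2 by rewrite hsq; ring.
  by rewrite /E; ring.
have even_part : OP * E - q * W * T = 2.
  apply/eqP; rewrite -subr_eq0; apply/eqP; set y := _ - 2.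
  (* [E] has constant term 2 and need not be a unit. It is cancelled through [PE]: multiplied by [P]
     it becomes 2 F^2, where 2 is regular and [F] is a unit. *)
  have Ey : E * y = 0.
    have -> : E * y = OP * (E ^+ 2 - q * T ^+ 2) + q * T * (OP * T - W * E) - 2 * E.
      by rewrite /y; ring.
    rewrite E2 WE subrr mulr0 addr0.
    have -> : OP * (2 * A1 * E) = 2 * (OP * A1) * E by ring.
    by rewrite OPA; ring.
  have : F ^+ 2 * y = 0 by apply: two_reg; rewrite mulrA -PE -mulrA Ey mulr0.
  move=> Fy; rewrite -[y]mul1r -[1](mulr1 1) -{1 2}FV.
  have -> : F * iF * (F * iF) * y = iF ^+ 2 * (F ^+ 2 * y) by ring.
  by rewrite Fy mulr0.
have GE : (OP + x * W) * (E - x * T) = 2.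
  rewrite -even_part /q.
  transitivity (OP * E - x ^+ 2 * W * T + x * (W * E - OP * T)); first by ring.
  by rewrite WE subrr mulr0 addr0.
have VE : V * (E - x * T) = 2 by rewrite -hV /E; congr (V * _); ring.
(* Both [V] and [OP + x * W] give 2 when multiplied by [E - x * T]. Replacing each 2 in twice their
   difference by the product with the other series leaves two equal terms. *)
apply/eqP; rewrite -subr_eq0; apply/eqP; apply: two_reg.
by rewrite mulrBr -{1}GE -VE; ring.
Qed.

End Dissection.

(** * The ring Z[X]/(X^(n+1)) *)

Section TruncatedSeries.
Variable n : nat.
Local Notation Xn := ('X^(n.+1) : {poly int}).

Lemma coef_in_qpolyXn (p : {poly int}) i : (i <= n)%N -> (in_qpoly Xn p : {poly int})`_i = p`_i.
Proof.
move=> hi; rewrite /= mk_monic_Xn.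
by rewrite [in RHS](Pdiv.RingMonic.rdivp_eq (monicXn _ n.+1) p) coefD coefMXn ltnS hi add0r.
Qed.

Lemma qpolyXn_nilpotent : in_qpoly Xn 'X ^+ n.+1 = 0.
Proof.
rewrite -rmorphXn; apply: val_inj => /=.
by rewrite mk_monic_Xn Pdiv.RingMonic.rmodpp ?monicXn.
Qed.

Lemma qpolyXn_two_reg (y : {poly %/ Xn}) : 2 * y = 0 -> y = 0.
Proof.
rewrite mulr_natl mulr2n => yy; apply: val_inj.
have e : (y : {poly int}) + y = 0 := congr1 val yy.
apply/polyP => i; rewrite coef0.
by have := congr1 (fun p : {poly int} => p`_i) e; rewrite coefD coef0 -mulr2n
  => /eqP; rewrite mulrn_eq0 => /eqP.
Qed.

End TruncatedSeries.

(** * Counting overpartitions by comparing coefficients *)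

Lemma sum_indicator (T : finType) (P Q : pred T) :
  \sum_(f | P f) (Q f)%:R = #|[set f | P f && Q f]|%:Z.
Proof.
rewrite -sum1dep_card big_mkcondr /= -natz natr_sum.
by apply: eq_bigr => f _; case: (Q f).
Qed.

Theorem theorem6 (v : int -> int)
  (hneg : forall n : int, n < 0 -> v n = 0)
  (hrec : forall n : nat,
     v n%:Z + \sum_(1 <= j < n.+1)
        (-1) ^+ j * (v (n%:Z - (j ^ 2)%N%:Z) + v (n%:Z - (2 * j ^ 2)%N%:Z))
     = (n == 0%N)%:R) :
  forall m : nat,
    v (2 * m)%N%:Z = (pbar m)%:Z /\ v (2 * m + 1)%N%:Z = (pbar_r m)%:Z.
Proof.
move=> m.
(* Modulo X^(2m+2) the coefficients at 2m and 2m + 1 survive, and q = X^2 satisfies q^(m+1) = 0,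
   matching the bound m on part sizes. *)
pose Xn : {poly int} := 'X^((2 * m + 1).+1).
pose tr : {rmorphism {poly int} -> {poly %/ Xn}} := in_qpoly Xn.
have xN : tr 'X ^+ (2 * m.+1) = 0.
  by rewrite -(qpolyXn_nilpotent (2 * m + 1)); congr (_ ^+ _); lia.
have := gen_dissection (@qpolyXn_two_reg _) xN hneg hrec.
pose V : {poly int} := \poly_(n < 2 * m.+1) v n%:Z.
(* A lift of O(X^2) + X W(X^2) to genuine polynomials, whose coefficients count configurations. *)
pose G : {poly int} := \sum_(f : {ffun 'I_m -> 'I_m.+1 * bool}) 'X^(2 * opart_weight f)
  + \sum_(f : {ffun 'I_m -> 'I_m.+1 * bool * bool} | ropart_ok f) 'X^((2 * ropart_weight f).+1).
have -> : gen (2 * m.+1) (tr 'X) v 0 = tr V.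
  rewrite /V poly_def rmorph_sum; apply: eq_bigr => n _ /=.
  have e : (v n%:Z)%:P = (v n%:Z)%:~R :> {poly int} by rewrite -{1}[v n]intz rmorph_int.
  by rewrite subr0 -mul_polyC e rmorphM rmorph_int rmorphXn.
have -> : opart_gf m (tr 'X ^+ 2) + tr 'X * ropart_gf m (tr 'X ^+ 2) = tr G.
  rewrite rmorphD !rmorph_sum /opart_gf /ropart_gf big_distrr; congr (_ + _); apply: eq_bigr => f _.
    by rewrite -exprM rmorphXn.
  by rewrite /= -exprM -exprS -(rmorphXn tr).
move=> VG.
have coefVG i : (i <= 2 * m + 1)%N -> v i%:Z = G`_i.
  move=> hi; rewrite -(coef_in_qpolyXn _ hi) -[in_qpoly _ _]VG coef_in_qpolyXn // coef_poly ifT //; lia.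
have coefG i : G`_i = \sum_(f : {ffun 'I_m -> 'I_m.+1 * bool}) (2 * opart_weight f == i)%N%:R
  + \sum_(f : {ffun 'I_m -> 'I_m.+1 * bool * bool} | ropart_ok f) ((2 * ropart_weight f).+1 == i)%N%:R.
  rewrite coefD !coef_sum; congr (_ + _); apply: eq_bigr => f _; by rewrite coefXn eq_sym.
(* The first sum has only even exponents and the second only odd ones, so each parity of the index
   selects one of them. *)
split; rewrite coefVG ?coefG ?sum_indicator; try lia.
  rewrite [X in _ + X%:Z](_ : _ = 0%N) ?addr0; last first.
    by apply: eq_card0 => f; rewrite !inE; apply/negP => /andP[_ /eqP]; lia.
  by congr Posz; apply: eq_card => f; rewrite !inE eqn_pmul2l.
rewrite [X in X%:Z + _](_ : _ = 0%N) ?add0r; last first.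
  by apply: eq_card0 => f; rewrite !inE; apply/negP => /eqP; lia.
by congr Posz; apply: eq_card => f; rewrite !inE addn1 eqSS eqn_pmul2l.
Qed.
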